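(* Let $A=(|A|,0_A,S_A)$ be a $\delta$-algebra. There exists a unique homomorphism of $\delta$-algebras $\operatorname{rec}_A\colon \mathbb{N}_\delta\to A$. If $S_A$ is injective and $0_A\notin\operatorname{im}(S_A)$, then $\operatorname{rec}_A$ is injective. If, in addition, $A$ satisfies induction for all predicates, then $\operatorname{rec}_A$ is bijective and is the unique $\delta$-algebra isomorphism from $\mathbb{N}_\delta$ to $A$.
   Context: The ambient metatheory is intuitionistic type theory (no excluded middle, no choice); carriers are types in a fixed universe $\mathrm{Type}_u$, and a predicate on a carrier $K$ is a map $K\to\mathrm{Prop}$. The $\delta$-orbit $\mathbb{N}_\delta$ is the inductively generated type of finite records with two constructors: $0$ (the empty record) and $r\mapsto Sr$ (one-step extension). A $\delta$-algebra is a triple $A=(|A|,0_A,S_A)$ where $|A|$ is a carrier, $0_A\in|A|$, and $S_A\colon|A|\to|A|$ is a unary operation. A homomorphism $f\colon A\to B$ of $\delta$-algebras is a map $f\colon|A|\to|B|$ with $f(0_A)=0_B$ and $f(S_Ax)=S_Bf(x)$ for all $x\in|A|$. The orbit is a $\delta$-algebra $(\mathbb{N}_\delta,0,S)$. ''$A$ satisfies induction for all predicates'' means: for every predicate $P$ on $|A|$, if $P(0_A)$ holds and $P(x)\to P(S_Ax)$ for every $x\in|A|$, then $P(x)$ holds for every $x\in|A|$. *)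

(* Defs.v *)
From Stdlib Require Export FinFun.

Inductive orbit : Set :=
| orbit_zero : orbit
| orbit_succ : orbit -> orbit.

Record delta_algebra : Type := DeltaAlgebra {
  carrier :> Type;
  zero : carrier;
  step : carrier -> carrier
}.

Arguments zero A : rename.
Arguments step A x : rename.

Definition orbit_algebra : delta_algebra :=
  DeltaAlgebra orbit orbit_zero orbit_succ.

Definition is_hom (A B : delta_algebra) (f : A -> B) : Prop :=
  f (zero A) = zero B /\ forall x : A, f (step A x) = step B (f x).

Arguments is_hom {A B} f.

(* Injective and surjective, not [FinFun.Bijective]: the latter asks for an
   inverse function, which in the absence of (unique) choice is strictly
   stronger.  For the same reason an isomorphism is a bijective homomorphism. *)
Definition is_bijective {X Y : Type} (f : X -> Y) : Prop :=
  Injective f /\ Surjective f.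

Definition is_iso {A B : delta_algebra} (f : A -> B) : Prop :=
  is_hom f /\ is_bijective f.

Definition in_image {X Y : Type} (f : X -> Y) (y : Y) : Prop :=
  exists x : X, f x = y.

Definition satisfies_induction (A : delta_algebra) : Prop :=
  forall P : A -> Prop,
    P (zero A) -> (forall x : A, P x -> P (step A x)) -> forall x : A, P x.

(* Main.v *)
Require Import Defs.
From Stdlib Require Import FunctionalExtensionality.

(** The orbit is freely generated by its two constructors, so structural
    recursion yields a homomorphism into any algebra, and structural induction
    shows that any two homomorphisms out of the orbit agree pointwise; function
    extensionality turns this into equality of maps ([hom_from_orbit_unique]).

    If [step A] is injective and misses [zero A], two records with the same
    value must have the same outermost constructor, and injectivity cancels one
    step on both sides ([orbit_fold_injective]).  The image of any homomorphism
    contains [zero] and is closed under [step], so induction in the target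
    forces it to be everything ([hom_surjective]).  Since an isomorphism is in
    particular a homomorphism, its uniqueness is that of homomorphisms. *)

Fixpoint orbit_fold (A : delta_algebra) (r : orbit) : A :=
  match r with
  | orbit_zero => zero A
  | orbit_succ r' => step A (orbit_fold A r')
  end.

Lemma orbit_fold_hom (A : delta_algebra) :
  is_hom (A := orbit_algebra) (orbit_fold A).
Proof. split; reflexivity. Qed.

Lemma hom_from_orbit_unique (A : delta_algebra) (f g : orbit_algebra -> A) :
  is_hom f -> is_hom g -> f = g.
Proof.
  intros [f0 fS] [g0 gS].
  apply functional_extensionality; intros r.
  induction r as [|r IH].
  - exact (eq_trans f0 (eq_sym g0)).
  - exact (eq_trans (fS r) (eq_trans (f_equal (step A) IH) (eq_sym (gS r)))).
Qed.

(** The induction on the first record keeps the second one general, because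
    cancelling a step shortens both records at once. *)
Lemma orbit_fold_injective (A : delta_algebra) :
  Injective (step A) -> ~ in_image (step A) (zero A) ->
  Injective (orbit_fold A).
Proof.
  intros step_inj zero_not_step r.
  induction r as [|r IH]; intros [|s] e; simpl in e.
  - reflexivity.
  - destruct zero_not_step. exists (orbit_fold A s). now symmetry.
  - destruct zero_not_step. now exists (orbit_fold A r).
  - apply f_equal, IH, step_inj, e.
Qed.

Lemma hom_surjective (A B : delta_algebra) (f : A -> B) :
  is_hom f -> satisfies_induction B -> Surjective f.
Proof.
  intros [f0 fS] ind.
  refine (ind (in_image f) _ _).
  - now exists (zero A).
  - intros y [x <-]. now exists (step A x).
Qed.

Theorem theorem1p6 (A : delta_algebra) :
  exists rec : orbit_algebra -> A,
    unique is_hom rec /\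
    (Injective (step A) -> ~ in_image (step A) (zero A) ->
       Injective rec /\
       (satisfies_induction A ->
          is_bijective rec /\ unique is_iso rec)).
Proof.
  exists (orbit_fold A).
  pose proof (orbit_fold_hom A) as fold_hom.
  split.
  - split; [exact fold_hom|].
    intros g g_hom. now apply hom_from_orbit_unique.
  - intros step_inj zero_not_step.
    pose proof (orbit_fold_injective A step_inj zero_not_step) as fold_inj.
    split; [exact fold_inj|].
    intros ind.
    assert (fold_bij : is_bijective (orbit_fold A)).
    { split; [exact fold_inj|].
      exact (hom_surjective orbit_algebra A _ fold_hom ind). }
    split; [exact fold_bij|].
    split; [exact (conj fold_hom fold_bij)|].
    intros g [g_hom _]. now apply hom_from_orbit_unique.
Qed.
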